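(* Let $\mathbf{k}$ be a field and let $S=\mathbf{k}[x_1,\ldots,x_n]$. Let $(P_a)_{a\in A}$ be any (possibly infinite) collection of subspaces of linear forms in $S$ such that $\dim P_a\le r$ for every $a\in A$. Consider the intersection of the corresponding linear ideals $I=\bigcap_{a\in A}(P_a)$. Then the number of generators of $I$ of degree $2$ is at most $r^2$, i.e., $\dim_{\mathbf{k}} I_2/(S_1\cdot I_1)\le r^2$.
   Context: A subspace of linear forms is a $\mathbf{k}$-linear subspace of $S_1$, the degree $1$ part of $S$ with its standard grading. For a subspace of linear forms $P$, $(P)$ denotes the ideal of $S$ generated by $P$. For a homogeneous ideal $I\subset S$, $I_d$ denotes its degree $d$ part, and the number of generators of $I$ of degree $d$ is defined as $\dim I_d/(S_1\cdot I_{d-1})$, where $S_1\cdot I_{d-1}$ is the span of all products of a linear form with an element of $I_{d-1}$. *)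

(* Defs.v *)
From HB Require Import structures.
From mathcomp Require Import all_boot all_order all_algebra.
From mathcomp.multinomials Require Import mpoly.
From Stdlib Require Import ClassicalEpsilon.

Set Implicit Arguments.
Unset Strict Implicit.
Unset Printing Implicit Defensive.

Import GRing.Theory.
Local Open Scope ring_scope.

(* [forms k n d] is S_d for S = {mpoly k[n]}.  The library makes [dhomog n k d]
   a [vectType] only when n is a successor; this alias is one for all n. *)
Definition forms (k : fieldType) (n d : nat) : Type := dhomog n k d.

Identity Coercion dhomog_of_forms : forms >-> dhomog.

HB.instance Definition _ (k : fieldType) (n d : nat) :=
  GRing.Lmodule.copy (forms k n d) (dhomog n k d).

Fact forms_vecaxiom (k : fieldType) (n d : nat) :
  Vector.axiom #|basis n d| (forms k n d).
Proof.
pose b := [seq s2m t | t : d.-tuple 'I_n <- enum (basis n d)].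
have szb : size b = #|basis n d| by rewrite size_map -cardE.
pose M i := nth 0%MM b i.
pose f (p : forms k n d) := \row_(i < #|basis n d|) (p : {mpoly k[n]})@_(M i).
exists f => /= [c p q|].
  by apply/rowP=> i; rewrite !mxE /= mcoeffD mcoeffZ.
pose g (r : 'rV[k]_(#|basis n d|)) : {mpoly k[n]} :=
  \sum_(i < #|basis n d|) (r 0 i) *: 'X_[M i].
have dhg r : g r \is d.-homog.
  rewrite rpred_sum //= => i _; apply/rpredZ.
  by rewrite dhomogX /= basis_cover -/b mem_nth // szb.
exists (fun r => DHomog (dhg r)); last first.
  move=> r; apply/rowP=> i.
  rewrite mxE /= /g raddf_sum /= (bigD1 i) //=.
  rewrite mcoeffZ mcoeffX eqxx mulr1 big1 ?addr0 //.
  move=> j ne_ji; rewrite mcoeffZ mcoeffX /M.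
  rewrite nth_uniq ?szb ?uniq_basis //.
  by rewrite (inj_eq val_inj) (negbTE ne_ji) mulr0.
move=> p; apply/val_inj/mpolyP => m /=; rewrite /g raddf_sum /=.
have [m_b | mNb] := boolP (m \in b).
  have lt_m : (index m b < #|basis n d|)%N by rewrite -szb index_mem.
  rewrite (bigD1 (Ordinal lt_m)) //= mxE mcoeffZ mcoeffX /M /= nth_index //.
  rewrite eqxx mulr1 big1 ?addr0 // => j ne_j; rewrite mcoeffZ mcoeffX.
  case: eqP => [e|]; last by rewrite mulr0.
  case/eqP: ne_j; apply/val_inj; rewrite /= -e index_uniq ?szb //.
  exact: uniq_basis.
rewrite big1 => [|i _]; last first.
  rewrite mcoeffZ mcoeffX; case: eqP => [e|]; last by rewrite mulr0.
  by case/negP: mNb; rewrite -e mem_nth // szb.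
symmetry; apply: (@dhomog_nemf_coeff _ _ mdeg d); first exact: dhomog_is_dhomog.
by rewrite basis_cover.
Qed.

HB.instance Definition _ (k : fieldType) (n d : nat) :=
  Lmodule_hasFinDim.Build k (forms k n d) (forms_vecaxiom k n d).

Section VSpan.
Variables (k : fieldType) (V : vectType k).
Implicit Types (Q : V -> Prop) (U : {vspace V}).

Definition is_vspan Q U : Prop :=
  (forall v, Q v -> v \in U) /\
  (forall U', (forall v, Q v -> v \in U') -> (U <= U')%VS).

(* The linear span of {v | Q v}; epsilon because Q is not decidable.  It is
   well defined by [vspan_spec]. *)
Definition vspan Q : {vspace V} := epsilon (inhabits 0%VS) (is_vspan Q).

Lemma vspan_spec Q : is_vspan Q (vspan Q).
Proof.
apply: epsilon_spec.
suff H m : forall U, (\dim {:V} - \dim U <= m)%N ->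
    (forall U', (forall v, Q v -> v \in U') -> (U <= U')%VS) ->
    exists U, is_vspan Q U.
  by apply: (H _ 0%VS (leqnn _)) => U' _; exact: sub0v.
elim: m => [|m IHm] U leU minU;
  case: (excluded_middle_informative (forall v, Q v -> v \in U)) => [sQU|NsQU];
  try by exists U.
- case: NsQU => v _; move: leU; rewrite leqn0 subn_eq0 => leU.
  have /eqP -> : U == fullv by rewrite eqEdim subvf.
  exact: memvf.
have [v [Qv NUv]] : exists v, Q v /\ v \notin U.
  apply: NNPP => nex; apply: NsQU => v Qv; apply/negPn/negP => NUv.
  by apply: nex; exists v.
apply: (IHm (U + <[v]>)%VS); last first.
  by move=> U' sQU'; rewrite subv_add minU //= -memvE sQU'.
have ltU : (\dim U < \dim (U + <[v]>))%N.
  rewrite (ltn_leqif (dimv_leqif_sup (addvSl _ _))) subv_add subvv /=.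
  by rewrite -memvE.
have leF := dimvS (subvf (U + <[v]>)%VS).
rewrite leq_subLR in leU; rewrite leq_subLR (leq_trans leU) //.
by rewrite addnS -addSn leq_add2r.
Qed.

Lemma mem_vspan Q v : Q v -> v \in vspan Q.
Proof. by have [+ _] := vspan_spec Q; apply. Qed.

Lemma vspan_sub Q U : (forall v, Q v -> v \in U) -> (vspan Q <= U)%VS.
Proof. by have [_ +] := vspan_spec Q; apply. Qed.

Lemma vspan_ind Q (C : V -> Prop) :
  C 0 -> (forall a u v, C u -> C v -> C (a *: u + v)) ->
  (forall v, Q v -> C v) -> forall v, v \in vspan Q -> C v.
Proof.
move=> C0 CD CQ v; have [sC _] := vspan_spec C.
have inC s : (forall u, u \in s -> C u) -> forall u, u \in <<s>>%VS -> C u.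
  move=> sCs u us; rewrite (coord_span (X := in_tuple s) us).
  elim/big_rec: _ => // i w _ Cw.
  by apply: (CD _ _ _ _ Cw); apply: sCs; rewrite mem_nth.
suff [s sCs sQs] : exists2 s : seq V, (forall u, u \in s -> C u) &
    forall u, Q u -> u \in <<s>>%VS.
  by move=> /(subvP (vspan_sub sQs)); apply: inC.
suff H m : forall s, (\dim {:V} - \dim <<s>> <= m)%N ->
    (forall u, u \in s -> C u) -> exists2 s : seq V,
    (forall u, u \in s -> C u) & forall u, Q u -> u \in <<s>>%VS.
  exact: (H _ [::] (leqnn _)).
elim: m => [|m IHm] s les sCs;
  case: (excluded_middle_informative (forall u, Q u -> u \in <<s>>%VS))
    => [sQs|NsQs]; try by exists s.
- case: NsQs => u _; move: les; rewrite leqn0 subn_eq0 => les.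
  have /eqP -> : <<s>>%VS == fullv by rewrite eqEdim subvf.
  exact: memvf.
have [u [Qu Nsu]] : exists u, Q u /\ u \notin <<s>>%VS.
  apply: NNPP => nex; apply: NsQs => u Qu; apply/negPn/negP => Nsu.
  by apply: nex; exists u.
apply: (IHm (u :: s)) => [|w]; last first.
  by rewrite inE => /predU1P[->|/sCs //]; apply: CQ.
have lts : (\dim <<s>> < \dim <<u :: s>>)%N.
  rewrite span_cons addvC (ltn_leqif (dimv_leqif_sup (addvSl _ _))).
  by rewrite subv_add subvv /= -memvE.
rewrite leq_subLR in les; rewrite leq_subLR (leq_trans les) //.
by rewrite addnS -addSn leq_add2r.
Qed.

End VSpan.

Section Ideals.
Variables (k : fieldType) (n : nat).
Local Notation S := {mpoly k[n]}.
Implicit Types (I : S -> Prop) (d : nat).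

Definition is_ideal I : Prop :=
  [/\ I 0, forall f g, I f -> I g -> I (f + g) & forall f g, I g -> I (f * g)].

(* The ideal (P): finite sums of products c.1 * c.2 with c.2 in P. *)
Definition linear_ideal (P : {vspace forms k n 1}) : S -> Prop := fun f =>
  exists s : seq (S * forms k n 1),
    (forall c, c \in s -> c.2 \in P) /\ f = \sum_(c <- s) c.1 * (c.2 : S).

Definition ideal_bigcap (A : Type) (J : A -> S -> Prop) : S -> Prop :=
  fun f => forall a, J a f.

(* For an ideal I the spanning family is already a subspace: [degree_partP]. *)
Definition degree_part I d : {vspace forms k n d} :=
  vspan (fun f : forms k n d => I f).

(* S_1 * I_(d-1) as a subspace of S_d; it is 0 when d = 0. *)
Definition S1_mul_part I d : {vspace forms k n d} :=
  vspan (fun f : forms k n d =>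
    exists (e : nat) (l : forms k n 1) (g : forms k n e),
      [/\ e.+1 = d, g \in degree_part I e & (f : S) = (l : S) * (g : S)]).

(* The dimension of I_d / (S_1 * I_(d-1)): vector.v has no quotient spaces, and
   [U :\: W] is a complement of W in U when W <= U, hence isomorphic to U / W;
   see [S1_mul_part_sub] and [num_generatorsE]. *)
Definition num_generators I d : nat :=
  \dim (degree_part I d :\: S1_mul_part I d)%VS.

Lemma linear_ideal_is_ideal P : is_ideal (linear_ideal P).
Proof.
split=> [|f g [s [sP ->]] [t [tP ->]]|f g [s [sP ->]]].
- by exists [::]; rewrite big_nil.
- exists (s ++ t); split; last by rewrite big_cat.
  by move=> c; rewrite mem_cat => /orP[/sP|/tP].
exists [seq (f * c.1, c.2) | c <- s]; split=> [c /mapP[c' /sP c'P ->] //|].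
by rewrite big_map mulr_sumr; apply: eq_bigr => c _; rewrite mulrA.
Qed.

Lemma ideal_bigcap_is_ideal (A : Type) (J : A -> S -> Prop) :
  (forall a, is_ideal (J a)) -> is_ideal (ideal_bigcap J).
Proof.
move=> idJ; split=> [a|f g If Ig a|f g Ig a]; case: (idJ a) => J0 JD JM //.
- exact: JD.
- exact: JM.
Qed.

Lemma degree_partP I d (f : forms k n d) :
  is_ideal I -> f \in degree_part I d <-> I f.
Proof.
case=> I0 ID IM; split; last exact: mem_vspan.
apply: (vspan_ind (C := fun f : forms k n d => I f)) => // a u v Iu Iv /=.
by apply: ID Iv; rewrite -mul_mpolyC; apply: IM.
Qed.

Lemma S1_mul_part_sub I d :
  is_ideal I -> (S1_mul_part I d <= degree_part I d)%VS.
Proof.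
move=> idI; apply: vspan_sub => f [e [l [g [_ /(degree_partP _ idI) Ig fE]]]].
apply/(degree_partP _ idI); rewrite fE.
by case: idI => _ _; apply.
Qed.

Lemma num_generatorsE I d : is_ideal I ->
  num_generators I d = (\dim (degree_part I d) - \dim (S1_mul_part I d))%N.
Proof.
move=> /(S1_mul_part_sub d)/capv_idPr cI.
by rewrite -(dimv_cap_compl (degree_part I d) (S1_mul_part I d)) cI addKn.
Qed.

End Ideals.

(* Main.v *)
Require Import Defs.
From mathcomp Require Import all_boot all_order all_algebra.
From mathcomp.multinomials Require Import mpoly.
From Stdlib Require Import ClassicalEpsilon.

(** Write V = S_1, and R W for the span in S_2 of the products of a form of R
    and a form of W, where R and W are subspaces of V.  The heart of the matter
    is a fact about two subspaces R and P of V: with D a complement of R :&: P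
    in R,

      a quadric of R V that lies in (P) belongs to (R :&: P) V + D P

    ([form_prod_linear_ideal]).  It comes from an endomorphism pi of the ring S
    that kills P, fixes D and moves every linear form by an element of P.  A
    quadric q of (P) is q - pi q, and for l in D and v in V the difference
    l v - pi (l v) is l (v - pi v), a product of a form of D and a form of P.

    The subspace D P has dimension at most \dim D * r when \dim P <= r.  Hence
    the part of I_2 lying in R V exceeds the part lying in (R :&: P_a) V by at
    most (\dim R - \dim (R :&: P_a)) * r dimensions.  Cutting R down by one
    P_a after another, which takes finitely many steps although the family may
    be infinite, one arrives at a subspace of all the P_a, that is of I_1, for
    which R V is inside S_1 I_1.  The drops of dimension telescope, so I_2 and
    R V meet in dimension at most \dim (S_1 I_1) + \dim R * r
    ([dim_capv_form_prod]).  Every quadric of (P_a) is in P_a V, so R = P_a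
    gives the theorem for a nonempty family.  For the empty one, I = S, and
    I_2 = S_1 I_1 because S_2 = V V. *)

Set Implicit Arguments.
Unset Strict Implicit.
Unset Printing Implicit Defensive.

Import GRing.Theory.
Local Open Scope ring_scope.

Section QuadricGenerators.
Variables (k : fieldType) (n : nat).
Local Notation S := {mpoly k[n]}.
Local Notation V := (forms k n 1).
Implicit Types (u v w l : V) (q : forms k n 2) (R W P D : {vspace V}).

(** * Products of spaces of linear forms *)

Fact form_mul_subproof u v : (u : S) * (v : S) \is 2.-homog.
Proof. exact: (dhomogM (dhomog_is_dhomog u) (dhomog_is_dhomog v)). Qed.

Definition form_mul u v : forms k n 2 := DHomog (form_mul_subproof u v).

Lemma form_mulDZl a u v w :
  form_mul (a *: u + v) w = a *: form_mul u w + form_mul v w.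
Proof. by apply: val_inj; rewrite /= mulrDl scalerAl. Qed.

Lemma form_mulDZr a u v w :
  form_mul u (a *: v + w) = a *: form_mul u v + form_mul u w.
Proof. by apply: val_inj; rewrite /= mulrDr scalerAr. Qed.

Lemma form_mulC u v : form_mul u v = form_mul v u.
Proof. by apply: val_inj; rewrite /= mulrC. Qed.

Lemma form_mul0 u : form_mul u 0 = 0.
Proof. by apply: val_inj; rewrite /= mulr0. Qed.

Definition form_prod R W : {vspace forms k n 2} :=
  vspan (fun q => exists u v, [/\ u \in R, v \in W & q = form_mul u v]).

Lemma mem_form_prod R W u v :
  u \in R -> v \in W -> form_mul u v \in form_prod R W.
Proof. by move=> Ru Wv; apply: mem_vspan; exists u, v. Qed.

Lemma form_prod_sub R W (U : {vspace forms k n 2}) :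
  (forall u v, u \in R -> v \in W -> form_mul u v \in U) ->
  (form_prod R W <= U)%VS.
Proof. by move=> sU; apply: vspan_sub => _ [u [v [Ru Wv ->]]]; apply: sU. Qed.

Lemma dim_form_prod R W : (\dim (form_prod R W) <= \dim R * \dim W)%N.
Proof.
pose X := [seq form_mul u v | u <- vbasis R, v <- vbasis W].
have szX : size X = (\dim R * \dim W)%N by rewrite size_allpairs !size_tuple.
rewrite -szX; apply: leq_trans (dim_span X); apply/dimvS/form_prod_sub => u v.
move=> /coord_vbasis -> /coord_vbasis ->.
elim/big_rec: _ => [|i w _ IHw]; first by rewrite form_mulC form_mul0 mem0v.
rewrite form_mulDZl rpredD ?rpredZ // {w IHw}.
elim/big_rec: _ => [|j w _ IHw]; first by rewrite form_mul0 mem0v.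
rewrite form_mulDZr rpredD ?rpredZ // memv_span //.
by apply: allpairs_f; rewrite mem_nth // size_tuple.
Qed.

Fact form_X_subproof (i : 'I_n) : ('X_i : S) \is 1.-homog.
Proof. by rewrite dhomogX /= mdeg1. Qed.

Definition form_X i : V := DHomog (form_X_subproof i).

Lemma linear_formE u : u = \sum_i (u : S)@_U_(i) *: form_X i.
Proof.
apply/val_inj/mpolyP => m; rewrite /= [in RHS]raddf_sum raddf_sum /=.
have [/mdeg1P[i /eqP ->]|m1] := boolP (mdeg m == 1%N).
  rewrite (bigD1 i) //= mcoeffZ mcoeffX eqxx mulr1 big1 ?addr0 // => j ji.
  by rewrite mcoeffZ mcoeffX eq_mnm1 (negbTE ji) mulr0.
rewrite (dhomog_nemf_coeff (dhomog_is_dhomog u)) // big1 // => i _.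
rewrite mcoeffZ mcoeffX; case: eqP => [mE|_]; last by rewrite mulr0.
by rewrite -mE mdeg1 in m1.
Qed.

Lemma mdeg2_mnm1D (m : 'X_{1..n}) :
  mdeg m = 2%N -> exists i j, m = (U_(i) + U_(j))%MM.
Proof.
move=> m2; have /existsP[i mi] : [exists i, m i != 0%N].
  rewrite -negb_forall; apply/negP => /forallP m0.
  suff m00 : m = 0%MM by rewrite m00 mdeg0 in m2.
  by apply/mnmP => i; rewrite mnm0E; apply/eqP.
have Uim : (m - U_(i) + U_(i))%MM = m by rewrite submK // lep1mP.
have /mdeg1P[j /eqP mj] : mdeg (m - U_(i)) == 1%N.
  by move/(congr1 mdeg): Uim; rewrite mdegD mdeg1 m2 addn1 => -[->].
by exists j, i; rewrite -mj Uim.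
Qed.

Lemma form_prod_fullv : form_prod fullv fullv = fullv.
Proof.
apply/eqP; rewrite eqEsubv subvf; apply/subvP => q _.
suff [q' q'VV qq'] : exists2 q', q' \in form_prod fullv fullv & (q : S) = q'.
  by rewrite (val_inj qq').
have /dhomogP := dhomog_is_dhomog q; rewrite [X in exists2 q', _ & X = _]mpolyE.
elim: (msupp q) => [|m s IHs] deg2.
  by exists 0; rewrite ?mem0v // big_nil.
have [|q' q'VV q'E] := IHs.
  by move=> m' sm'; apply: deg2; rewrite inE sm' orbT.
have [i [j mE]] := mdeg2_mnm1D (deg2 m (mem_head _ _)).
exists ((q : S)@_m *: form_mul (form_X i) (form_X j) + q').
  by rewrite rpredD ?rpredZ ?mem_form_prod ?memvf.
by rewrite big_cons q'E /= -mpolyXD -mE.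
Qed.

(** * Quadrics of a linear ideal *)

(** The ring endomorphism of S that extends [phi], see [linear_subst_form]. *)
Definition linear_subst (phi : 'End(V)) (f : S) : S :=
  f \mPo [tuple (phi (form_X i) : S) | i < n].

Lemma linear_subst_form phi u : linear_subst phi u = phi u.
Proof.
rewrite [in RHS](linear_formE u) /linear_subst [in LHS](linear_formE u).
rewrite linear_sum /= !raddf_sum /=; apply: eq_bigr => i _.
by rewrite !linearZ /= comp_mpolyXU -tnth_nth tnth_mktuple.
Qed.

Lemma linear_subst_ideal (phi : 'End(V)) P f :
  (forall u, u \in P -> phi u = 0) ->
  linear_ideal P f -> linear_subst phi f = 0.
Proof.
move=> phiP [s [sP ->]]; rewrite /linear_subst raddf_sum big1_seq //= => c.
move=> /sP cP; rewrite rmorphM /= -/(linear_subst phi c.2) linear_subst_form.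
by rewrite phiP ?mulr0.
Qed.

(** Adding to [D] a complement of [P + D] gives a complement of [P]; the
    projection onto it along [P] is as required. *)
Lemma proj_along P D : (D :&: P = 0)%VS -> exists phi : 'End(V),
  [/\ forall u, u \in P -> phi u = 0, forall u, u \in D -> phi u = u
    & forall u, u - phi u \in P].
Proof.
move=> DP0; pose M := (D + (P + D)^C)%VS.
have MP0 : (M :&: P = 0)%VS.
  apply/eqP; rewrite -subv0; apply/subvP => x; rewrite memv_cap => /andP[].
  case/memv_addP => d Dd [e Ee ->] Px.
  have e0 : e = 0.
    apply/eqP; rewrite -memv0 -(capv_compl (P + D)%VS) memv_cap Ee andbT.
    rewrite -(addKr d e) addrC; apply: memv_add => //.
    by rewrite memvN.
  by move: Px; rewrite e0 addr0 -DP0 memv_cap Dd.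
have PM0 : (P :&: M = 0)%VS by rewrite capvC.
have piE u : daddv_pi M P u + daddv_pi P M u = u.
  apply: daddv_pi_add => //; rewrite /M addvC addvA.
  by rewrite addv_complf memvf.
exists (daddv_pi M P); split=> u.
- by move=> Pu; apply: (addIr u); rewrite add0r -{2}(daddv_pi_id PM0 Pu).
- by move=> Du; rewrite daddv_pi_id // (subvP (addvSl _ _)).
by rewrite -{1}(piE u) addrC addKr memv_pi.
Qed.

(** Let pi be the ring endomorphism extending the projection of [proj_along],
    for D = R :\: P.  Products [c * v] with c in R :&: P have pi (c v) = 0, and
    d v - pi (d v) = d (v - pi v) for d in D; so q - pi q is in the right-hand
    side for every quadric q of R V, and pi q = 0 when q is in (P). *)
Lemma form_prod_linear_ideal R P q :
  q \in form_prod R fullv -> linear_ideal P q ->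
  q \in (form_prod (R :&: P) fullv + form_prod (R :\: P) P)%VS.
Proof.
have [phi [phiP phiD phi_sub]] := proj_along (capv_diff R P).
set U := (_ + _)%VS => RVq /(linear_subst_ideal phiP) q0.
suff [q' Uq' q'E] : exists2 q', q' \in U & (q : S) - linear_subst phi q = q'.
  by rewrite q0 subr0 in q'E; rewrite (val_inj q'E).
move: q RVq {q0}; apply: vspan_ind => [|a q1 q2 [p1 Up1 E1] [p2 Up2 E2]|q'].
- by exists 0; rewrite ?mem0v // /linear_subst /= raddf0 subrr.
- exists (a *: p1 + p2); first by rewrite rpredD ?rpredZ.
  rewrite /= -E1 -E2 /linear_subst comp_mpolyD comp_mpolyZ scalerBr.
  by rewrite addrACA opprD.
move=> [u [v [+ _ ->]]] {q'}; rewrite -{1}(addv_diff_cap R P).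
case/memv_addP => d Dd [c]; rewrite memv_cap => /andP[Rc Pc] ->.
exists (form_mul c v + form_mul d (v - phi v)).
  by apply: memv_add; apply: mem_form_prod; rewrite ?memvf // memv_cap Rc.
have phi_dc : linear_subst phi ((d : S) + (c : S)) = d.
  apply: etrans (linear_subst_form phi (d + c)) _.
  by rewrite linearD /= phiD // phiP // addr0.
rewrite /linear_subst rmorphM /= -!/(linear_subst phi _) linear_subst_form.
rewrite phi_dc mulrDl mulrBr.
by rewrite addrAC addrC.
Qed.

(** The case R = V of [form_prod_linear_ideal], since S_2 = V V. *)
Lemma linear_ideal_sub_form_prod P q :
  linear_ideal P q -> q \in form_prod P fullv.
Proof.
move=> Pq; have := @form_prod_linear_ideal fullv P q.
rewrite form_prod_fullv memvf capfv => /(_ isT Pq); apply/subvP.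
rewrite subv_add subvv; apply: form_prod_sub => u v _ Pv.
by rewrite form_mulC mem_form_prod ?memvf.
Qed.

(** * Quadrics of an intersection of linear ideals *)

Variables (r : nat) (A : Type) (P_ : A -> {vspace V}).
Hypothesis dimP : forall a, (\dim (P_ a) <= r)%N.
Local Notation I := (ideal_bigcap (fun a => linear_ideal (P_ a))).

Let ideal_I : is_ideal I.
Proof. by apply: ideal_bigcap_is_ideal => a; apply: linear_ideal_is_ideal. Qed.

Lemma form_prod_sub_S1_mul_part R :
  (forall a, R <= P_ a)%VS -> (form_prod R fullv <= S1_mul_part I 2)%VS.
Proof.
move=> sRP; apply: form_prod_sub => u v Ru _; rewrite form_mulC.
apply: mem_vspan; exists 1%N, v, u; split=> //; apply: mem_vspan => a.
exists [:: (1, u)]; split; last by rewrite big_seq1 mul1r.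
by move=> c; rewrite inE => /eqP -> /=; apply: subvP Ru.
Qed.

(** The induction on [\dim R] intersects [R] with any [P_ a] not containing it.
    The bound is linear in [\dim R], so the cost of each step,
    [\dim (R :\: P_ a) * r], is exactly what the bound gains; the induction ends
    at an [R] contained in all the [P_ a]. *)
Lemma dim_capv_form_prod R :
  (\dim (degree_part I 2 :&: form_prod R fullv)
     <= \dim (S1_mul_part I 2) + \dim R * r)%N.
Proof.
have [m] := ubnP (\dim R); elim: m R => // m IHm R; rewrite ltnS => leRm.
have [sRP|NsRP] := excluded_middle_informative (forall a, R <= P_ a)%VS.
  rewrite (leq_trans _ (leq_addr _ _)) // dimvS //.
  exact: subv_trans (capvSr _ _) (form_prod_sub_S1_mul_part sRP).
have [a NsRPa] : exists a, ~~ (R <= P_ a)%VS.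
  apply: NNPP => nex; apply: NsRP => a; apply/negPn/negP => NsRPa.
  by apply: nex; exists a.
have ltR : (\dim (R :&: P_ a) < \dim R)%N.
  by rewrite (ltn_leqif (dimv_leqif_sup (capvSl _ _))) subv_cap subvv.
set X := form_prod (R :&: P_ a) fullv; set Y := form_prod (R :\: P_ a) (P_ a).
have leY : (\dim Y <= \dim (R :\: P_ a) * r)%N.
  by rewrite (leq_trans (dim_form_prod _ _)) // leq_mul2l dimP orbT.
set W := (_ :&: _)%VS.
have sWXY : (W + X <= X + Y)%VS.
  rewrite subv_add addvSl andbT; apply/subvP => q; rewrite memv_cap.
  move=> /andP[/(degree_partP _ ideal_I)/(_ a) Pq RVq].
  exact: form_prod_linear_ideal.
(* A summand in [X] of a quadric of I_2 need not be in I_2, so that [W] may fail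
   to be inside [degree_part I 2 :&: X + Y]: dimensions are compared modulo
   [X]. *)
have leW : (\dim W <= \dim (degree_part I 2 :&: X) + \dim Y)%N.
  rewrite -(leq_add2r (\dim X)) -dimv_sum_cap [leqLHS]addnC -addnA leq_add //.
    by rewrite dimvS // subv_cap capvSr (subv_trans (capvSl _ _)) ?capvSl.
  rewrite addnC; apply: leq_trans (dimvS sWXY) _.
  exact: (dimv_add_leqif X Y).
apply: leq_trans leW _.
rewrite -(dimv_cap_compl R (P_ a)) mulnDl addnA leq_add //.
exact: IHm (leq_trans ltR leRm).
Qed.

End QuadricGenerators.

Theorem theoremB (k : fieldType) (n r : nat) (A : Type)
    (P : A -> {vspace forms k n 1})
    (dimP : forall a : A, (\dim (P a) <= r)%N) :
  (num_generators (ideal_bigcap (fun a : A => linear_ideal (P a))) 2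
     <= r ^ 2)%N.
Proof.
set I := ideal_bigcap _; have ideal_I : is_ideal I.
  by apply: ideal_bigcap_is_ideal => a; apply: linear_ideal_is_ideal.
rewrite num_generatorsE // leq_subLR.
have [[a _]|NA] := excluded_middle_informative (exists _ : A, True); last first.
  rewrite (leq_trans _ (leq_addr _ _)) // dimvS // (subv_trans (subvf _)) //.
  rewrite -form_prod_fullv form_prod_sub_S1_mul_part // => a.
  by case: NA; exists a.
have /capv_idPl <- : (degree_part I 2 <= form_prod (P a) fullv)%VS.
  apply/subvP => q /(degree_partP _ ideal_I)/(_ a).
  exact: linear_ideal_sub_form_prod.
by rewrite (leq_trans (dim_capv_form_prod dimP _)) // leq_add2l -mulnn leq_mul.
Qed.
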